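(* Let $C_1$ and $C_2$ be proper polyhedral cones. The following are equivalent: (1) The pair $(C_1,C_2)$ has the Lorentz factorization property (LFP). (2) Either $C_1$ or $C_2$ is classical.
   Context: All vector spaces are real and finite-dimensional. A convex cone $C\subseteq V$ is proper if it is closed, pointed ($C\cap(-C)=\{0\}$) and generating (it spans $V$). A face of $C$ is a convex cone $F\subseteq C$ such that $x\in F$, $y,z\in C$, $x=y+z$ imply $y,z\in F$; an extremal ray is a $1$-dimensional face. A proper cone is polyhedral if it has finitely many extremal rays, and classical if it has exactly $\dim V$ extremal rays. For $n\ge 1$ the Lorentz cone is $L_n=\{(t,x_1,\dots,x_{n-1})\in\mathbb{R}^n : t\ge (x_1^2+\cdots+x_{n-1}^2)^{1/2}\}$; a cone is Lorentzian if it is linearly isomorphic to some $L_n$. For proper cones $C_1\subseteq V_1$, $C_2\subseteq V_2$, $\mathrm{Pos}(C_1,C_2)$ is the set of linear maps $P:V_1\to V_2$ with $P(C_1)\subseteq C_2$, and $\mathrm{LorFact}(C_1,C_2)=\operatorname{conv}\{\beta\alpha : \alpha\in\mathrm{Pos}(C_1,L),\ \beta\in\mathrm{Pos}(L,C_2),\ L \text{ a Lorentzian cone}\}$. The pair $(C_1,C_2)$ has the Lorentz factorization property (LFP) if $\mathrm{LorFact}(C_1,C_2)=\mathrm{Pos}(C_1,C_2)$. *)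

(* Defs.v *)
From HB Require Import structures.
From mathcomp Require Import all_boot all_order all_algebra.
From mathcomp Require Import all_classical all_reals all_analysis.

Set Implicit Arguments.
Unset Strict Implicit.
Unset Printing Implicit Defensive.

Import Order.TTheory GRing.Theory Num.Theory.
Import numFieldNormedType.Exports.

Local Open Scope classical_set_scope.
Local Open Scope ring_scope.

Definition convex_cone (R : realType) (V : vectType R) (C : set V) : Prop :=
  [/\ C 0,
      forall x y, C x -> C y -> C (x + y)
    & forall (a : R) x, 0 <= a -> C x -> C (a *: x)].

(* A vectType carries no topology; the canonical topology of a               *)
(* finite-dimensional real vector space is transported from row vectors by    *)
(* the linear isomorphism v2r (the result does not depend on the choice of    *)
(* coordinates).                                                              *)
Definition vclosed (R : realType) (V : vectType R) (C : set V) : Prop :=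
  closed (VectorInternalTheory.v2r @` C).

(* U is the linear span of the (possibly infinite) set A. *)
Definition is_span (R : realType) (V : vectType R) (A : set V)
    (U : {vspace V}) : Prop :=
  A `<=` [set` U] /\ forall W : {vspace V}, A `<=` [set` W] -> (U <= W)%VS.

Definition pointed (R : realType) (V : vectType R) (C : set V) : Prop :=
  C `&` [set x | C (- x)] = [set 0].

Definition generating (R : realType) (V : vectType R) (C : set V) : Prop :=
  is_span C fullv.

Definition proper_cone (R : realType) (V : vectType R) (C : set V) : Prop :=
  [/\ convex_cone C, vclosed C, pointed C & generating C].

Definition face (R : realType) (V : vectType R) (C F : set V) : Prop :=
  [/\ convex_cone F, F `<=` C
    & forall x y z, F x -> C y -> C z -> x = y + z -> F y /\ F z].

(* The dimension of a face is the dimension of its linear span. *)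
Definition extremal_ray (R : realType) (V : vectType R) (C F : set V) : Prop :=
  face C F /\ exists2 U : {vspace V}, is_span F U & \dim U = 1%N.

Definition polyhedral (R : realType) (V : vectType R) (C : set V) : Prop :=
  finite_set [set F | extremal_ray C F].

Definition classical_cone (R : realType) (V : vectType R) (C : set V) : Prop :=
  ([set F | extremal_ray C F] #= `I_(\dim {:V}))%card.

(* The Lorentz cone of R^(n+1): coordinate 0 is t, and the remaining n are    *)
(* x_1, ..., x_n.                                                             *)
Definition lorentz_cone (R : realType) (n : nat) : set 'rV[R]_n.+1 :=
  [set x | Num.sqrt (\sum_(i < n) x 0 (lift ord0 i) ^+ 2) <= x 0 ord0].

Definition lorentzian (R : realType) (W : vectType R) (L : set W) : Prop :=
  exists n (f : 'Hom(W, 'rV[R]_n.+1)), bijective f /\ f @` L = @lorentz_cone R n.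

Definition Pos (R : realType) (V1 V2 : vectType R) (C1 : set V1) (C2 : set V2) :
    set 'Hom(V1, V2) :=
  [set P | P @` C1 `<=` C2].

Definition convex_hull (R : realType) (E : lmodType R) (A : set E) : set E :=
  smallest (@convex_set R E) A.

Definition LorFact (R : realType) (V1 V2 : vectType R)
    (C1 : set V1) (C2 : set V2) : set 'Hom(V1, V2) :=
  convex_hull [set P | exists (W : vectType R) (L : set W),
    lorentzian L /\
    exists (alpha : 'Hom(V1, W)) (beta : 'Hom(W, V2)),
      [/\ Pos C1 L alpha, Pos L C2 beta & P = (beta \o alpha)%VF]].

Definition LFP (R : realType) (V1 V2 : vectType R)
    (C1 : set V1) (C2 : set V2) : Prop :=
  LorFact C1 C2 = Pos C1 C2.

(* Main.v *)
(* If C1 or C2 is simplicial, expanding along its coordinates writes every    *)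
(* positive map as a sum of rank-one maps, which factor through L_1.          *)
(* Conversely, a polyhedral cone with more extremal rays than its dimension   *)
(* has a facet g missing two extremal rays d3, d4, and a facet f together     *)
(* with a face disjoint from f that is not a single ray.  In that face pick   *)
(* x, y with f x = f y = 1, a functional a >= 0 vanishing on the face and a   *)
(* functional a1 >= 0 with a1 x = 0, a1 y = 1 and a1 <= f on the face.  With   *)
(* d3, d4 scaled so that g d3 = g d4 = 1, h in the relative interior of the    *)
(* facet g, and M large, the map                                              *)
(*   W = f d3 + a1 (d4 - d3) + M a h                                          *)
(* is positive, W x = d3, W y = d4 and g o W = f.  In a decomposition of W    *)
(* into maps factoring through Lorentz cones, some term P = b o al has        *)
(* P x = c d3, P y = c d4 and g o P = c f with c > 0.  Then al x and al y     *)
(* are null vectors, and b kills their common orthogonal complement because   *)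
(* extremal rays of a polyhedral cone have no nontrivial tangent directions.  *)
(* So P = s d3 + t d4 with functionals s, t >= 0 and s + t = c f, which is    *)
(* impossible since f spans an extremal ray of the dual cone while            *)
(* s y = 0 = t x.                                                             *)
Require Import Defs.
From HB Require Import structures.
From mathcomp Require Import all_boot all_order all_algebra.
From mathcomp Require Import all_classical all_reals all_analysis.
From mathcomp Require Import ring lra.

Set Implicit Arguments.
Unset Strict Implicit.
Unset Printing Implicit Defensive.

Import Order.TTheory GRing.Theory Num.Theory.
Import numFieldNormedType.Exports VectorInternalTheory.

Local Open Scope classical_set_scope.
Local Open Scope ring_scope.

(** The obstruction behind the outline above is [lorentz_two_rays]: a Lorentz cone is round and a
    polyhedral cone is not ([extremal_tangent]), so a positive map from a Lorentz cone that reaches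
    two distinct extremal rays has rank two. [not_factorable] sets this against a facet functional.
    When neither cone is simplicial, [facet_missing_two] and [face_off_facet] supply the ingredients
    of a positive map to which it applies, in [LFP_simplicial]; the converse is [simplicial_LFP].
    Minkowski's theorem, through [polyhedral_generators], reduces the convex geometry to finitely
    many vectors, and [farkas] and [farkas_mod_ray] provide the separating functionals. *)

(** * Linear functionals and the Farkas lemma *)

Section Functionals.
Variable R : realType.

Lemma hom_of_fun (V W : vectType R) (F : V -> W) :
  (forall (a : R) x y, F (a *: x + y) = a *: F x + F y) ->
  exists f : 'Hom(V, W), forall x, f x = F x.
Proof.
move=> linF.
pose L : {linear V -> W} :=
  HB.pack F (GRing.isLinear.Build R V W ( *:%R ) F linF).
by exists (linfun L) => x; rewrite lfunE.
Qed.

Lemma functional_of_fun (V : vectType R) (F : V -> R) :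
  (forall (a : R) x y, F (a *: x + y) = a * F x + F y) ->
  exists f : 'Hom(V, R^o), forall x, f x = F x.
Proof. by move=> linF; apply: (@hom_of_fun V R^o). Qed.

Lemma functionalD (V : vectType R) (f : 'Hom(V, R^o)) x y :
  f (x + y) = f x + f y :> R.
Proof. exact: linearD. Qed.

Lemma functionalN (V : vectType R) (f : 'Hom(V, R^o)) x : f (- x) = - f x :> R.
Proof. exact: linearN. Qed.

Lemma functionalZ (V : vectType R) (f : 'Hom(V, R^o)) (a : R) x :
  f (a *: x) = a * f x :> R.
Proof. exact: linearZ. Qed.

Definition functionalE := (functionalD, functionalN, functionalZ).

Lemma functional_neg (V : vectType R) (b : V) :
  b != 0 -> exists f : 'Hom(V, R^o), f b < 0.
Proof.
move=> b0; pose n := \dim {:V}; pose X := vbasis {:V}.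
have [i ci] : exists i, coord X i b != 0.
  apply/existsP; apply: contraNT b0 => /existsPn c0.
  rewrite (coord_vbasis (memvf b)) big1// => i _.
  by move/negPn/eqP: (c0 i) => ->; rewrite scale0r.
have [f fE] : exists f : 'Hom(V, R^o), forall x, f x = - coord X i b * coord X i x.
  by apply: functional_of_fun => a x y; rewrite linearP/= mulrDr mulrCA.
by exists f; rewrite fE mulNr oppr_lt0 -expr2 exprn_even_gt0.
Qed.

Lemma convex_coneP (V : vectType R) (K : set V) : convex_cone K ->
  forall (a b : R) x y, 0 <= a -> 0 <= b -> K x -> K y -> K (a *: x + b *: y).
Proof. by move=> [_ KD KZ] a b x y a0 b0 Kx Ky; apply: KD; apply: KZ. Qed.

(* Induction on the list: if the functional obtained for the tail is negative *)
(* at the head [v], project along [v] onto the kernel of that functional.     *)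
Lemma farkas (V : vectType R) (s : seq V) (b : V) :
  (exists f : 'Hom(V, R^o), (forall x, x \in s -> 0 <= f x) /\ f b < 0) \/
  (forall K : set V, convex_cone K -> (forall x, x \in s -> K x) -> K b).
Proof.
have [n] := ubnP (size s); elim: n s b => // n IHn [|v s] b /=.
  move=> _; have [->|/functional_neg[f fb]] := eqVneq b 0.
    by right=> K [].
  by left; exists f.
rewrite ltnS => sn; have [[f [f0 fb]]|Kb] := IHn s b sn; last first.
  by right=> K cK sK; apply: Kb => // x xs; apply: sK; rewrite in_cons xs orbT.
have [fv|fv] := leP 0 (f v).
  by left; exists f; split=> // x /[!in_cons] /orP[/eqP->|/f0].
pose pr x := x - (f x / f v) *: v.
have [|[h [h0 hb]]|Kb] := IHn [seq pr x | x <- s] (pr b); first by rewrite size_map.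
  have [h' h'E] : exists h' : 'Hom(V, R^o), forall x, h' x = h (pr x).
    apply: functional_of_fun => a x y; rewrite /pr !functionalE; field.
    by rewrite lt_eqF.
  left; exists h'; split; last by rewrite h'E.
  move=> x /[!in_cons] /orP[/eqP->|xs]; rewrite h'E.
    by rewrite /pr divff ?lt_eqF// scale1r subrr linear0.
  by apply: h0; apply: map_f.
right=> K cK sK.
have Kv : K v by apply: sK; rewrite mem_head.
have -> : b = 1 *: pr b + (f b / f v) *: v by rewrite scale1r subrK.
apply: convex_coneP => //; first by rewrite ltW// nmulr_rgt0// invr_lt0.
apply: Kb => // _ /mapP[x xs ->].
rewrite /pr -scaleNr -[x in x + _]scale1r; apply: convex_coneP => //.
  by rewrite -mulrN mulr_ge0 ?f0// oppr_ge0 invr_le0 ltW.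
by apply: sK; rewrite in_cons xs orbT.
Qed.

(** The ratio test of the simplex method: the smallest ratio [a i / p i] over [p i > 0] is the
    largest [t] keeping [a - t p] nonnegative. It is used to give a functional one more zero among
    the generators. *)
Lemma ratio_test (I : finType) (a p : I -> R) :
  (forall i, 0 <= a i) -> (forall i, 0 < p i -> 0 < a i) ->
  (exists i, 0 < p i) ->
  exists t i0, [/\ 0 < t, 0 < p i0, a i0 = t * p i0 & forall i, t * p i <= a i].
Proof.
move=> a0 ap [j pj].
case: (@arg_minP _ R I j (fun i => 0 < p i) (fun i => a i / p i) pj) => i pi mini.
exists (a i / p i), i; split => //; first by rewrite divr_gt0 ?ap.
  by rewrite divfK// gt_eqF.
move=> k; have [pk|pk] := ltP 0 (p k); first by rewrite -ler_pdivlMr// mini.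
by apply: le_trans (a0 k); rewrite mulr_ge0_le0// divr_ge0// ltW// ap.
Qed.

End Functionals.

(** * Extremal rays *)

Section ExtremalRays.
Variables (R : realType) (V : vectType R).
Implicit Types (C K F : set V) (x y z : V).

Definition extremal C x : Prop :=
  [/\ C x, x != 0
    & forall y z, C y -> C z -> x = y + z -> exists2 c : R, 0 <= c & y = c *: x].

Definition ray x : set V := [set y | exists2 c : R, 0 <= c & y = c *: x].

Lemma pointed_eq0 C x : pointed C -> C x -> C (- x) -> x = 0.
Proof. by move=> pC Cx CNx; have : [set 0] x by rewrite -pC. Qed.

Lemma extremal_ray_ray C x : convex_cone C -> pointed C ->
  extremal C x -> extremal_ray C (ray x).
Proof.
move=> [C0 CD CZ] pC [Cx x0 xC]; split; last first.
  exists <[x]>%VS; last by rewrite dim_vline x0.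
  split=> [_ [c _ ->]|W rW]; first exact/memvZ/memv_line.
  by rewrite -memvE; apply: rW; exists 1; rewrite ?scale1r.
split=> [|_ [c c0 ->]|u y z [c c0 ->] Cy Cz cE]; last 1 first.
- have [c00|cn0] := eqVneq c 0.
    move: cE; rewrite c00 scale0r => /esym/eqP; rewrite addr_eq0 => /eqP yz.
    have y0 : y = 0 by apply: (pointed_eq0 pC Cy); rewrite yz opprK.
    by split; exists 0; rewrite // scale0r// -[z]opprK -yz y0 oppr0.
  have cI : 0 <= c^-1 by rewrite invr_ge0.
  have main v w : C v -> C w -> c *: x = v + w -> ray x v.
    move=> Cv Cw vw.
    have [|d d0 vE] := xC _ _ (CZ _ _ cI Cv) (CZ _ _ cI Cw).
      by rewrite -scalerDr -vw scalerA mulVf// scale1r.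
    exists (c * d); first exact: mulr_ge0.
    by rewrite -scalerA -vE scalerA divff// scale1r.
  by split; [exact: (main y z)|apply: (main z y) => //; rewrite addrC].
- split; first by exists 0; rewrite ?scale0r.
    by move=> _ _ [c c0 ->] [d d0 ->]; exists (c + d); rewrite ?addr_ge0// scalerDl.
  by move=> a _ a0 [c c0 ->]; exists (a * c); rewrite ?mulr_ge0// scalerA.
- exact: CZ.
Qed.

Lemma extremal_rayP C F : pointed C -> extremal_ray C F ->
  exists2 x, extremal C x & F = ray x.
Proof.
move=> pC [[[F0 FD FZ] FC Fface] [U [FU Umin] U1]].
have [x Fx x0] : exists2 x, F x & x != 0.
  apply: contrapT => nx; suff : (U <= 0)%VS by move/dimvS; rewrite U1 dimv0.
  apply: Umin => y Fy /=; rewrite memv0; apply/negPn/negP => y0.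
  by apply: nx; exists y.
have UE : U = <[x]>%VS.
  apply/esym/eqP; rewrite eqEdim dim_vline x0 U1 andbT -memvE.
  exact: (FU _ Fx).
have FE : F = ray x.
  apply/seteqP; split=> [y Fy|_ [c c0 ->]]; last exact: FZ.
  have : y \in U by exact: (FU _ Fy).
  rewrite UE => /vlineP[c yE]; exists c => //; rewrite leNgt; apply/negP => c0.
  move/eqP: x0; apply; apply: (pointed_eq0 pC); first exact: FC.
  have -> : - x = (- c)^-1 *: y.
    by rewrite yE scalerA invrN mulNr mulVf ?lt_eqF// scaleN1r.
  by apply/FC/FZ => //; rewrite invr_ge0 oppr_ge0 ltW.
exists x => //; split=> // [|y z Cy Cz xyz]; first exact: FC.
by have [] := Fface _ _ _ Fx Cy Cz xyz; rewrite FE.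
Qed.

Lemma spanning_seq (A : set V) :
  exists2 s : seq V, (forall x, x \in s -> A x) & A `<=` [set` << s >>%VS].
Proof.
suff main n (s : seq V) : (forall x, x \in s -> A x) ->
    (\dim {:V} < n + \dim << s >>)%N ->
    exists2 s : seq V, (forall x, x \in s -> A x) & A `<=` [set` << s >>%VS].
  by apply: (main (\dim {:V}).+1 [::]) => //; rewrite leq_addr.
elim: n s => [|n IHn] s sA; first by rewrite ltnNge dimvS ?subvf.
move=> ns; have [|/existsNP[x /not_implyP[Ax xs]]] :=
  pselect (A `<=` [set` << s >>%VS]); first by exists s.
apply: (IHn (x :: s)) => [y /[!in_cons] /orP[/eqP->|/sA]//|].
rewrite (leq_trans ns)// addSnnS leq_add2l ltnNge; apply/negP => ds.
suff /eqP E : << s >>%VS == << x :: s >>%VS.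
  by apply: xs; rewrite /= E memv_span ?mem_head.
by rewrite eqEdim ds andbT span_cons addvSr.
Qed.

(** The only place where [vclosed] is unfolded: the convexity arguments need closedness along lines
    only. *)
Lemma closed_line C x y : vclosed C -> closed [set t : R | C (x + t *: y)].
Proof.
move=> cC; pose g (t : R) := v2r x + t *: v2r y.
suff -> : [set t : R | C (x + t *: y)] = g @^-1` (v2r @` C).
  apply: preimage_closed cC => t _.
  apply: cvgD; first exact: cvg_cst.
  by apply: scalel_continuous.
apply/seteqP; split=> t /=; first by exists (x + t *: y); rewrite // linearD linearZ.
move=> [z Cz zE]; suff <- : z = x + t *: y by [].
by apply: v2r_inj; rewrite zE linearD linearZ.
Qed.

(** If [x - t y] stayed in [C] for arbitrarily large [t], dividing by [t] would put the limit [- y]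
    in [C], against pointedness. Closedness also makes the supremum attained. *)
Lemma maximal_subtraction C x y : convex_cone C -> vclosed C -> pointed C ->
  C x -> C y -> y != 0 ->
  exists t : R, [/\ 0 <= t, C (x - t *: y) & forall u, t < u -> ~ C (x - u *: y)].
Proof.
move=> [C0 CD CZ] cC pC Cx Cy y0.
pose T := [set t : R | C (x + t *: (- y))].
have T0 : T 0 by rewrite /T/= scale0r addr0.
have ubT : has_ubound T.
  apply: contrapT => nub; case/eqP: y0; apply: (pointed_eq0 pC Cy).
  have : closure [set t : R | C (- y + t *: x)] 0.
    move=> A /nbhs_ballP[e /= e0 eA].
    have /existsNP[t /not_implyP[Tt /negP]] : ~ ubound T e^-1.
      by move=> ub; apply: nub; exists e^-1.
    rewrite -ltNge => te; have t0 : 0 < t by apply: lt_trans te; rewrite invr_gt0.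
    exists t^-1; split=> /=.
      have -> : - y + t^-1 *: x = t^-1 *: (x + t *: (- y)).
        by rewrite scalerDr scalerA mulVf ?gt_eqF// scale1r addrC.
      by apply: CZ => //; rewrite invr_ge0 ltW.
    apply: eA; rewrite /ball/= sub0r normrN gtr0_norm ?invr_gt0//.
    by rewrite -[e]invrK ltf_pV2// posrE ?invr_gt0.
  by move/(closed_line cC); rewrite /= scale0r addr0.
exists (sup T); split.
- exact: ub_le_sup.
- by have /(closed_line cC) := closure_sup (ex_intro _ _ T0) ubT; rewrite /= scalerN.
- move=> u Tu Cu; have : u <= sup T by apply: ub_le_sup => //; rewrite /T/= scalerN.
  by rewrite leNgt Tu.
Qed.

(* The smallest face of [C] containing [x]. *)
Definition face_of C x : set V :=
  [set y | C y /\ exists2 k : R, 0 <= k & C (k *: x - y)].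

(** The two-sided bound, that [k x - y] and [k x + y] both lie in [C], is preserved by linear
    combinations, whereas membership in the face is not. *)
Lemma face_of_span C x (s : seq V) : convex_cone C -> C x ->
  (forall y, y \in s -> face_of C x y) ->
  forall y, C y -> y \in << s >>%VS -> face_of C x y.
Proof.
move=> [C0 CD CZ] Cx sF.
suff main y : y \in << s >>%VS ->
    exists k : R, [/\ 0 <= k, C (k *: x - y) & C (k *: x + y)].
  by move=> y Cy /main[k [k0 Ck _]]; split=> //; exists k.
elim: s y sF => [|v s IHs] y sF.
  by rewrite span_nil memv0 => /eqP->; exists 0; rewrite scale0r subr0 addr0.
rewrite span_cons => /memv_addP[_ /vlineP[c ->] [z zs ->]].
have [|k [k0 Ck Ck']] := IHs z _ zs.
  by move=> w ws; apply: sF; rewrite in_cons ws orbT.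
have [Cv [m m0 Cm]] := sF v (mem_head _ _).
exists (k + `|c| * m).
rewrite addr_ge0 ?mulr_ge0// !scalerDl -!scalerA.
have Cn : C (`|c| *: (m *: x - v)) by apply: CZ.
have Cp : C (`|c| *: (m *: x + v)) by apply/CZ/CD => //; apply: CZ.
have [c0|c0] := lerP 0 c.
- rewrite (ger0_norm c0) in Cn Cp *; split=> //.
    by have := CD _ _ Ck Cn; rewrite scalerBr opprD addrACA [- _ - _]addrC.
  by have := CD _ _ Ck' Cp; rewrite scalerDr addrACA [_ + z]addrC.
- rewrite (ltr0_norm c0) in Cn Cp *; split=> //.
    have := CD _ _ Ck Cp; rewrite [_ *: (_ + v)]scalerDr [- c *: v]scaleNr.
    by rewrite opprD addrACA [- _ - _]addrC.
  have := CD _ _ Ck' Cn; rewrite [_ *: (_ - v)]scalerBr [- c *: v]scaleNr opprK.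
  by rewrite addrACA [_ + z]addrC.
Qed.

(* Minkowski: a non-extremal [x] splits as [x' + t y'] with [x'] and [y']     *)
(* in strictly smaller faces, obtained by two maximal subtractions.           *)
Lemma generated_by_extremal C : convex_cone C -> vclosed C -> pointed C ->
  forall K, convex_cone K -> extremal C `<=` K -> C `<=` K.
Proof.
move=> cvC cC pC K [K0 KD KZ] eK x; have [C0 CD CZ] := cvC.
have [s sF Fs] := spanning_seq (face_of C x).
have [n] := ubnP (\dim << s >>); elim: n x s sF Fs => // n IHn x s sF Fs.
rewrite ltnS => sn Cx.
have [->//|x0] := eqVneq x 0.
have [/eK//|nex] := pselect (extremal C x).
have {nex}[y [z [Cy Cz xyz ny]]] : exists y z, [/\ C y, C z, x = y + z &
    forall c : R, 0 <= c -> y <> c *: x].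
  apply: contrapT => nyz; apply: nex; split=> // y z Cy Cz xyz.
  apply: contrapT => nc; apply: nyz; exists y, z; split=> // c c0 yE.
  by apply: nc; exists c.
have {}IHn w u : C w -> face_of C w `<=` face_of C x -> face_of C x u ->
    ~ face_of C w u -> K w.
  move=> Cw wx xu nwu; have [s' sF' Fs'] := spanning_seq (face_of C w).
  apply: (IHn _ _ sF' Fs') => //; apply: leq_trans sn.
  have ss : (<< s' >> <= << s >>)%VS by apply/span_subvP => v /sF'/wx/Fs.
  rewrite ltn_neqAle dimvS// andbT; apply: contraPneq nwu => ds; apply.
  apply: (face_of_span cvC Cw sF'); first by case: xu.
  suff -> : << s' >>%VS = << s >>%VS by exact: Fs.
  by apply/eqP; rewrite eqEdim ss ds /=.
have [r [r0 Cr maxr]] := maximal_subtraction cvC cC pC Cy Cx x0.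
pose y' := y - r *: x.
have y'0 : y' != 0 by rewrite subr_eq0; apply/eqP/ny.
have [t [t0 Ct maxt]] := maximal_subtraction cvC cC pC Cx Cr y'0.
have Fxx : face_of C x x by split=> //; exists 1; rewrite // scale1r subrr.
have Cxy' : C (x - y').
  have -> : x - y' = z + r *: x.
    rewrite opprB addrCA [RHS]addrC; congr (_ + _).
    by apply/eqP; rewrite subr_eq addrC -xyz.
  by apply/CD/CZ.
(* If [x] lay in the face of [y'], a further multiple of [x] could be subtracted from [y], against
   the maximality of [r]; likewise for [y'], the face of [x - t y'] and [t]. *)
have not_below u v k : 0 <= k -> C v -> v != 0 -> C (k *: u - v) ->
    exists2 e : R, 0 < e & C (u - e *: v).
  rewrite le_eqVlt => /orP[/eqP<-|k0] Cv v0 Cuv.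
    by case/eqP: v0; apply: (pointed_eq0 pC Cv); rewrite -[- v]add0r -(scale0r u).
  exists k^-1; first by rewrite invr_gt0.
  have := CZ k^-1 _ _ Cuv; rewrite scalerBr scalerA mulVf ?gt_eqF// scale1r.
  by apply; rewrite invr_ge0 ltW.
have Ky' : K y'.
  apply: (IHn y' x) => // [w [Cw [k k0 Ck]]|[_ [k k0 Ck]]].
    split=> //; exists k => //; have := CD _ _ (CZ k _ k0 Cxy') Ck.
    by rewrite scalerBr addrA subrK.
  have [e e0] := not_below _ _ _ k0 Cx x0 Ck.
  rewrite -addrA -opprD -scalerDl; apply: maxr.
  by rewrite ltrDl.
have Kx' : K (x - t *: y').
  apply: (IHn _ y') => // [w [Cw [k k0 Ck]]||[_ [k k0 Ck]]].
  - split=> //; exists k => //.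
    have := CD _ _ Ck (CZ (k * t) y' (mulr_ge0 k0 t0) Cr).
    by rewrite scalerBr scalerA addrAC subrK.
  - by split=> //; exists 1; rewrite // scale1r.
  - have [e e0] := not_below _ _ _ k0 Cr y'0 Ck.
    by rewrite -addrA -opprD -scalerDl; apply: maxt; rewrite ltrDl.
by rewrite -[x](subrK (t *: y')); apply/KD/KZ.
Qed.

End ExtremalRays.

(** * Polyhedral cones *)

Section Generators.
Variables (R : realType) (V : vectType R).
Implicit Types (C K F : set V) (x y z : V).

(* Stating generation by minimality rather than by nonnegative combinations  *)
(* reduces every use to exhibiting a convex cone containing the [v i].        *)
Definition generators C m (v : 'I_m -> V) : Prop :=
  [/\ forall i, extremal C (v i),
      forall i j (c : R), v i = c *: v j -> i = j
    & forall K, convex_cone K -> (forall i, K (v i)) -> C `<=` K].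

Lemma polyhedral_generators C : proper_cone C -> polyhedral C ->
  exists m (v : 'I_m -> V),
    generators C v /\ (classical_cone C <-> m = \dim {:V}).
Proof.
move=> [cvC cC pC gC] /finite_setP[m Em]; exists m.
have [r [rE rinj rsurj]] : exists r : nat -> set V,
    set_bij `I_m [set F | extremal_ray C F] r.
  by apply/card_set_bijP; rewrite card_eq_sym.
have vP (i : 'I_m) : exists x, extremal C x /\ r i = ray x.
  by have [x] := extremal_rayP pC (rE i (ltn_ord i)); exists x.
have [v {}vP] := choice vP; exists v; split; last first.
  rewrite /classical_cone; split=> [Ed|<-//]; apply/card_eq_II.
  by apply: card_eq_trans Ed; rewrite card_eq_sym.
split=> [i|i j c ijc|K cvK vK].
- by have [] := vP i.
- have [[Ci vi0 _] ri] := vP i; have [[Cj vj0 _] rj] := vP j.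
  have c0 : 0 < c.
    rewrite ltNge; apply/negP => c0; case/eqP: vi0; apply: (pointed_eq0 pC Ci).
    rewrite ijc -scaleNr; case: cvC => _ _; apply => //.
    by rewrite oppr_ge0.
  apply/val_inj/rinj; rewrite ?inE/= ?ltn_ord// ri rj ijc.
  apply/seteqP; split=> _ [d d0 ->].
    by exists (d * c); rewrite ?mulr_ge0 ?(ltW c0)// scalerA.
  exists (d / c); first by rewrite divr_ge0 ?(ltW c0).
  by rewrite scalerA divfK// gt_eqF.
- apply: (generated_by_extremal cvC cC pC cvK) => x xC.
  have [i /= im riE] := rsurj _ (extremal_ray_ray cvC pC xC).
  have [_ ri] := vP (Ordinal im).
  have : ray x x by exists 1; rewrite ?scale1r.
  rewrite -riE ri => -[c c0 ->].
  by case: cvK => _ _; apply.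
Qed.

Section Theory.
Variables (C : set V) (m : nat) (v : 'I_m -> V).
Hypotheses (properC : proper_cone C) (genC : generators C v).

Lemma extremal_dominates x y (c : R) : extremal C x -> C y -> 0 <= c ->
  C (c *: x - y) -> exists2 d : R, 0 <= d & y = d *: x.
Proof.
have [[C0 CD CZ] _ pC _] := properC.
move=> [Cx x0 xC] Cy; rewrite le_eqVlt => /orP[/eqP<-|c0] Cxy.
  exists 0 => //; rewrite scale0r; apply: (pointed_eq0 pC Cy).
  by rewrite scale0r add0r in Cxy.
have cI : 0 <= c^-1 by rewrite invr_ge0 ltW.
have [|d d0 yE] := xC _ _ (CZ _ _ cI Cy) (CZ _ _ cI Cxy).
  by rewrite -scalerDr addrC subrK scalerA mulVf ?gt_eqF// scale1r.
exists (c * d); first by rewrite mulr_ge0// ltW.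
by rewrite -scalerA -yE scalerA divff ?gt_eqF// scale1r.
Qed.

Lemma extremalZ x (c : R) : 0 < c -> extremal C x -> extremal C (c *: x).
Proof.
have [[C0 CD CZ] _ _ _] := properC.
move=> c0 xC; have [Cx x0 _] := xC; split; first exact/CZ/Cx/ltW.
  by rewrite scaler_eq0 negb_or gt_eqF.
move=> y z Cy Cz yz.
have [|d d0 ->] := extremal_dominates xC Cy (ltW c0); first by rewrite yz addrAC subrr add0r.
by exists (d / c); rewrite ?divr_ge0 ?(ltW c0)// scalerA divfK ?gt_eqF.
Qed.

Lemma generator_in i : C (v i).
Proof. by have [e _ _] := genC; have [] := e i. Qed.

Lemma generators_ge0 (f : 'Hom(V, R^o)) :
  (forall i, 0 <= f (v i)) -> forall x, C x -> 0 <= f x.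
Proof.
move=> f0 x Cx; have [_ _ gK] := genC.
apply: (gK [set x | 0 <= f x]) => //; split=> [|y z|a y a0] /=.
- by rewrite linear0.
- by rewrite functionalD; apply: addr_ge0.
- by rewrite functionalZ; apply: mulr_ge0.
Qed.

Lemma generators_eq0 (h : 'Hom(V, R^o)) :
  (forall i, h (v i) = 0) -> forall x, h x = 0.
Proof.
have [_ _ _ [_ spC]] := properC; have [_ _ gK] := genC.
move=> h0 x; apply/eqP; rewrite -memv_ker.
suff /subvP : (fullv <= lker h)%VS by apply; apply: memvf.
apply: spC; apply: gK => [|i]; last by rewrite /= memv_ker h0.
by split=> [|y z|a y _]; [exact: mem0v|exact: memvD|exact: memvZ].
Qed.

(** Farkas for the cone [C] enlarged by [- x]: a functional nonnegative on both [C] and [- x] must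
    vanish at [x]. *)
Lemma farkas_mod_ray x b : C x ->
  (exists f : 'Hom(V, R^o), [/\ forall i, 0 <= f (v i), f x = 0 & f b < 0]) \/
  (exists2 c : R, 0 <= c & C (b + c *: x)).
Proof.
have [[C0 CD CZ] _ _ _] := properC.
move=> Cx; have [[f [f0 fb]]|NCb] := farkas (- x :: codom v) b; [left|right].
  have fv j : 0 <= f (v j) by apply: f0; rewrite in_cons codom_f orbT.
  exists f; split=> //; apply/eqP; rewrite eq_le (generators_ge0 fv Cx) andbT.
  by rewrite -oppr_ge0 -functionalN f0// mem_head.
apply: (NCb [set z | exists2 c : R, 0 <= c & C (z + c *: x)]).
  split=> [|y z [c c0 Cy] [d d0 Cz]|a y a0 [c c0 Cy]].
  - by exists 0; rewrite // scale0r addr0.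
  - by exists (c + d); rewrite ?addr_ge0// scalerDl addrACA; apply: CD.
  - by exists (a * c); rewrite ?mulr_ge0// -scalerA -scalerDr; apply: CZ.
move=> z /[!in_cons] /orP[/eqP->|/codomP[j ->]].
  by exists 1; rewrite // scale1r addNr.
by exists 0; rewrite // scale0r addr0; apply: generator_in.
Qed.

(* Fails for cones that are not polyhedral, such as the Lorentz cone itself. *)
Lemma extremal_tangent x y z (e0 : R) : extremal C x -> 0 < e0 ->
  (forall e : R, `|e| <= e0 -> C (x + e *: y + e ^+ 2 *: z)) ->
  exists c : R, y = c *: x.
Proof.
have [[C0 CD CZ] _ _ _] := properC.
move=> xC e00 curve; have Cx : C x by case: xC.
have side y' : (forall e : R, 0 < e -> e <= e0 -> C (x + e *: y' + e ^+ 2 *: z)) ->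
    exists2 c : R, 0 <= c & C (y' + c *: x).
  move=> curve'; have [[f [f0 fx fy]]|//] := farkas_mod_ray y' Cx; exfalso.
  (* For [e <= d] the quadratic term is at most half the size of the negative linear term, so [f] is
     negative on the curve. *)
  pose d := - f y' / (2 * (1 + `|f z|)).
  have fz1 : 0 < 1 + `|f z| by rewrite ltr_pwDl.
  have d0 : 0 < d by rewrite divr_gt0 ?oppr_gt0 ?mulr_gt0.
  pose e := Num.min e0 d.
  have e1 : 0 < e by rewrite lt_min e00.
  have ee0 : e <= e0 by rewrite ge_min lexx.
  have ed : e <= d by rewrite ge_min lexx orbT.
  have := generators_ge0 f0 (curve' e e1 ee0).
  rewrite !functionalE fx add0r expr2 -mulrA -mulrDr pmulr_rge0// leNgt => /negP; apply.
  have efz : e * f z <= d * (1 + `|f z|).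
    apply: le_trans (_ : e * (1 + `|f z|) <= _); last by rewrite ler_pM2r.
    by rewrite ler_pM2l//; apply: le_trans (ler_norm _) _; rewrite lerDr.
  have dE : d * (1 + `|f z|) = - f y' / 2.
    by rewrite /d; field; rewrite gt_eqF.
  rewrite dE in efz; lra.
have [|c c0 Cc] := side y; first by move=> e e1 ee; apply: curve; rewrite gtr0_norm.
have [|d d0 Cd] := side (- y).
  move=> e e1 ee; have := curve (- e); rewrite normrN gtr0_norm// sqrrN scalerN -scaleNr.
  exact.
have [|b _ yE] := @extremal_dominates x (y + c *: x) (c + d) xC Cc (addr_ge0 c0 d0).
  by rewrite scalerDl addrC opprD -addrA addKr.
by exists (b - c); rewrite scalerBl -yE addrK.
Qed.

Lemma generators_span : << [tuple v i | i < m] >>%VS = fullv.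
Proof.
have [_ _ _ [_ spC]] := properC; have [_ _ gK] := genC.
apply/eqP; rewrite eqEsubv subvf; apply: spC; apply: gK => [|i].
  by split=> [|y z|a y _]; [exact: mem0v|exact: memvD|exact: memvZ].
by apply: memv_span; apply/tnthP; exists i; rewrite tnth_mktuple.
Qed.

Lemma simplicial_coordinates : m = \dim {:V} ->
  exists f : 'I_m -> 'Hom(V, R^o), (forall i x, C x -> 0 <= f i x) /\
    forall x, x = \sum_i f i x *: v i.
Proof.
move=> md; pose X := [tuple v i | i < m].
have XE (i : 'I_m) : X`_i = v i by rewrite -tnth_nth tnth_mktuple.
have freeX : free X by rewrite /free /X generators_span size_tuple -md.
have fP i : exists f : 'Hom(V, R^o), forall x, f x = coord X i x.
  by apply: functional_of_fun => a x y; exact: linearP.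
have [f fE] := choice fP.
exists f; split=> [i|x].
  by apply: generators_ge0 => j; rewrite fE -XE coord_free.
under eq_bigr do rewrite fE -XE; apply: coord_span.
by rewrite /X generators_span memvf.
Qed.

(** For nonzero [g], the dual way to say that the generators killed by [g] span its kernel, so that
    [g] spans an extremal ray of the dual cone. The zero functional is allowed. *)
Definition facet (g : 'Hom(V, R^o)) : Prop :=
  (forall i, 0 <= g (v i)) /\
  forall h : 'Hom(V, R^o), (forall i, g (v i) = 0 -> h (v i) = 0) ->
  exists c : R, forall z, h z = c * g z.

(* A functional positive at [v k] with the largest number of zeros is a facet. *)
Lemma facet_positive_at k : exists2 g, facet g & 0 < g (v k).
Proof.
have [_ _ pC _] := properC; have [e _ _] := genC.
have [g0 g0_ge0 g0k] : exists2 g : 'Hom(V, R^o), forall i, 0 <= g (v i) & 0 < g (v k).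
  have [[f [f0 fk]]|NCk] := farkas (codom v) (- v k).
    exists f; last by rewrite functionalN oppr_lt0 in fk.
    by move=> i; apply/f0/codom_f.
  have [Ck /eqP[]] := e k; apply: (pointed_eq0 pC Ck); apply: NCk.
    by have [] := properC.
  by move=> _ /codomP[i ->]; apply: generator_in.
pose Z (g : 'Hom(V, R^o)) := [set i | g (v i) == 0]%SET.
have [n] := ubnP (m - #|Z g0|); elim: n g0 g0_ge0 g0k => // n IHn g g_ge0 gk gn.
have [|nfacet] := pselect (facet g); first by exists g.
have [h [hg nh]] : exists h : 'Hom(V, R^o),
    (forall i, g (v i) = 0 -> h (v i) = 0) /\ forall c : R, ~ forall z, h z = c * g z.
  apply: contrapT => nh; apply: nfacet; split=> // h hg.
  by apply: contrapT => hc; apply: nh; exists h; split=> // c hE; apply: hc; exists c.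
(* Correcting [h] to vanish at [v k] keeps [g - t p] positive there. The correction is nonzero
   because [h] is no multiple of [g], and up to sign it is positive at some generator, as the ratio
   test requires. *)
pose p0 := h - (h (v k) / g (v k)) *: g.
have p0E z : p0 z = h z - h (v k) / g (v k) * g z.
  by rewrite add_lfunE opp_lfunE scale_lfunE.
have [l p0l] : exists l, p0 (v l) != 0.
  apply: contrapT => np; apply: (nh (h (v k) / g (v k))) => z.
  apply/eqP; rewrite -subr_eq0 -p0E; apply/eqP/generators_eq0 => i.
  by apply/eqP/negPn/negP => pi0; apply: np; exists i.
have [p [pk pg pl]] : exists p : 'Hom(V, R^o), [/\ p (v k) = 0,
    forall i, g (v i) = 0 -> p (v i) = 0 & exists l, 0 < p (v l)].
  have p0k : p0 (v k) = 0 by rewrite p0E divfK ?gt_eqF// subrr.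
  have p0g i : g (v i) = 0 -> p0 (v i) = 0.
    by move=> gi; rewrite p0E gi mulr0 subr0 hg.
  have [pl|pl] := ltP 0 (p0 (v l)); first by exists p0; split=> //; exists l.
  exists (- p0); split=> [|i gi|]; rewrite ?opp_lfunE ?p0k ?oppr0 ?p0g ?oppr0//.
  by exists l; rewrite opp_lfunE oppr_gt0 lt_neqAle p0l.
have [i pi|t [j [t0 pj gj tp]]] := ratio_test g_ge0 _ pl.
  rewrite lt_neqAle g_ge0 andbT eq_sym; apply/eqP => gi.
  by move: pi; rewrite pg// ltxx.
pose g' := g - t *: p.
have g'E z : g' z = g z - t * p z by rewrite add_lfunE opp_lfunE scale_lfunE.
apply: (IHn g') => [i||]; first by rewrite g'E subr_ge0.
  by rewrite g'E pk mulr0 subr0.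
rewrite ltnS in gn; apply: leq_trans gn.
apply: ltn_sub2l; last first.
  apply: proper_card; apply/properP; split.
    apply/fintype.subsetP => i; rewrite !finset.inE => /eqP gi.
    by rewrite g'E gi pg// mulr0 subr0.
  exists j; rewrite !finset.inE; first by rewrite g'E gj subrr.
  by rewrite gj mulf_neq0 ?gt_eqF.
rewrite -[X in (_ < X)%N]card_ord -cardsT; apply: proper_card; apply/properP.
split; first exact: finset.subsetT.
by exists j; rewrite !finset.inE// gj mulf_neq0 ?gt_eqF.
Qed.

(** If every facet missed at most one generator, a facet functional positive at [v k] would isolate
    the coefficient of [v k] in any linear relation, so the generators would form a basis. *)
Lemma facet_missing_two : m <> \dim {:V} ->
  exists g i j, [/\ facet g, i != j, 0 < g (v i) & 0 < g (v j)].
Proof.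
move=> mdim; apply: contrapT => nfacet; apply: mdim.
pose X := [tuple v i | i < m].
have XE (i : 'I_m) : X`_i = v i by rewrite -tnth_nth tnth_mktuple.
have freeX : free X.
  apply/freeP => c; under eq_bigr do rewrite XE; move=> cv k.
  have [g fg gk] := facet_positive_at k.
  have := congr1 g cv; rewrite linear0 linear_sum (bigD1 k)//= big1 => [|i ik].
    by rewrite addr0 functionalZ => /eqP; rewrite mulf_eq0 (gt_eqF gk) orbF => /eqP.
  rewrite functionalZ; suff -> : g (v i) = 0 by rewrite mulr0.
  apply/eqP; rewrite eq_le fg.1 andbT leNgt; apply/negP => gi.
  by apply: nfacet; exists g, i, k.
by rewrite -generators_span (eqP freeX) size_tuple.
Qed.

(** The sum is a relative interior point of the facet: a functional nonnegative on [C] and zero at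
    it vanishes on the whole facet, hence is a multiple of [g] and cannot be negative at [x]. *)
Lemma facet_absorb g x : facet g -> g x = 0 ->
  exists2 c : R, 0 <= c & C (x + c *: \sum_(i | g (v i) == 0) v i).
Proof.
have [[C0 CD CZ] _ _ _] := properC; move=> [g0 gmax] gx.
have Ch : C (\sum_(i | g (v i) == 0) v i).
  by apply: (big_ind C) => // i _; apply: generator_in.
have [[f [f0 fh fx]]|//] := farkas_mod_ray x Ch.
have [i gi|c fE] := gmax f; last by move: fx; rewrite fE gx mulr0 ltxx.
apply: (psumr_eq0P (P := fun i => g (v i) == 0) (F := fun i => f (v i))) => //.
- by rewrite -linear_sum.
- exact/eqP.
Qed.

(** A sum over [i != k] of functionals that vanish at [v k] and are positive at [v i]. Without such
    a functional, [v i] would lie below a multiple of [v k] and so on the same ray. *)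
Lemma exposing_functional k : exists e : 'Hom(V, R^o),
  [/\ forall i, 0 <= e (v i), e (v k) = 0 & forall i, i != k -> 0 < e (v i)].
Proof.
have [ex dist _] := genC.
have fP i : exists f : 'Hom(V, R^o), i != k ->
    [/\ forall i, 0 <= f (v i), f (v k) = 0 & 0 < f (v i)].
  have [_|ik] := eqVneq i k; first by exists 0.
  have [[f [f0 fk fi]]|[c c0 Cc]] := farkas_mod_ray (- v i) (generator_in k).
    by exists f => _; split=> //; rewrite functionalN oppr_lt0 in fi.
  case/negP: ik; apply/eqP; rewrite addrC in Cc.
  have [d _ viE] := extremal_dominates (ex k) (generator_in i) c0 Cc.
  exact: dist viE.
have [f {}fP] := choice fP; exists (\sum_(i | i != k) f i).
split=> [i||i ik]; rewrite sum_lfunE.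
- by apply: sumr_ge0 => j /fP[].
- by apply: big1 => j /fP[].
- rewrite (bigD1 i)//=; have [_ _ fi] := fP i ik.
  by apply: ltr_wpDr => //; apply: sumr_ge0 => j /andP[/fP[]].
Qed.

(* The zeros of [a] span a face of [C] disjoint from the facet [f], and [x],  *)
(* [y] are points of this face at which [a1 / f] is minimal and maximal.      *)
Lemma face_off_facet (f : 'Hom(V, R^o)) k l :
  (forall i, 0 <= f (v i)) -> k != l -> 0 < f (v k) -> 0 < f (v l) ->
  exists (a a1 : 'Hom(V, R^o)) x y, [/\ C x /\ C y,
    f x = 1 /\ f y = 1,
    a x = 0 /\ a y = 0,
    a1 x = 0 /\ a1 y = 1
  & forall i, [/\ 0 <= a (v i), 0 <= a1 (v i)
                & a (v i) = 0 -> a1 (v i) <= f (v i)]].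
Proof.
have [[C0 CD CZ] _ pC _] := properC; have [ex dist _] := genC.
move=> f0 kl fk fl; have [e [e0 ek ei]] := exposing_functional k.
have [h [h0 hkl]] : exists h : 'Hom(V, R^o), (forall i, 0 <= h (v i)) /\
    f (v k) * h (v l) < f (v l) * h (v k).
  have [[h [h0 hb]]|Cb] := farkas (codom v) (f (v k) *: v l - f (v l) *: v k).
    exists h; split=> [i|]; first exact/h0/codom_f.
    by rewrite !functionalE subr_lt0 in hb.
  have [||d _ vE] := @extremal_dominates (v l) (f (v l) *: v k) (f (v k)) (ex l) _ (ltW fk).
  - exact/CZ/generator_in/ltW.
  - by apply: Cb => [|_ /codomP[i ->]]; [split|exact: generator_in].
  case/eqP: kl; apply: (dist _ _ (d / f (v l))).
  by rewrite mulrC -scalerA -vE scalerA mulVf ?gt_eqF// scale1r.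
(* [p] vanishes at [v k], is positive at [v l], and is nonpositive at generators where [f] vanishes.
   So lowering [e] along [p] adds a zero besides [v k] and creates none on the facet [f]. *)
pose p := h (v k) *: f - f (v k) *: h.
have pE z : p z = h (v k) * f z - f (v k) * h z.
  by rewrite add_lfunE opp_lfunE !scale_lfunE.
have pk : p (v k) = 0 by rewrite pE mulrC subrr.
have [i pi||t [j [t0 pj ej tp]]] := @ratio_test R _ (e \o v) (p \o v) e0.
- by apply: ei; apply: contraTneq pi => ->; rewrite /= pk ltxx.
- by exists l; rewrite /= pE subr_gt0 [ltRHS]mulrC.
pose a := e - t *: p.
have aE z : a z = e z - t * p z by rewrite add_lfunE opp_lfunE scale_lfunE.
have af i : a (v i) = 0 -> 0 < f (v i).
  move=> ai; rewrite lt_neqAle f0 andbT eq_sym; apply/eqP => fi.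
  have ik : i != k by apply: contraTneq fk => <-; rewrite fi ltxx.
  have := ei i ik; move/eqP: ai; rewrite aE subr_eq0 => /eqP->.
  rewrite pE fi mulr0 sub0r mulrN oppr_gt0 ltNge; apply/negP/negPn.
  by rewrite !mulr_ge0// ltW.
have aj : a (v j) == 0 by rewrite aE [e _]ej /= subrr.
have jk : j != k by apply: contraTneq pj => ->; rewrite /= pk ltxx.
(* With [c] the largest ratio [e / f] on the zeros of [a], the functional [e / c] stays below [f]
   there and meets it at [v y]. *)
case: (@arg_maxP _ R 'I_m j (fun i => a (v i) == 0) (fun i => e (v i) / f (v i)) aj).
move=> y /eqP ay maxy; set c := e (v y) / f (v y) in maxy.
have c0 : 0 < c.
  apply: lt_le_trans (maxy j aj); apply: divr_gt0; first exact: ei.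
  exact/af/eqP.
have fy := af _ ay.
exists a, (c^-1 *: e), ((f (v k))^-1 *: v k), ((f (v y))^-1 *: v y).
rewrite !scale_lfunE !functionalE ek ay !mulr0 [a (v k)]aE ek pk.
rewrite ?(mulr0, subr0, scaler0) !mulVf ?gt_eqF//.
split=> //.
- by split; apply: CZ (generator_in _); rewrite invr_ge0 ltW.
- split=> //; rewrite -[RHS](mulVf (lt0r_neq0 c0)) /c.
  by congr (_ * _); rewrite mulrC.
move=> i; rewrite scale_lfunE; split.
- by rewrite aE subr_ge0; apply: tp.
- by rewrite mulr_ge0 ?e0// invr_ge0 ltW.
- move=> ai; rewrite [_ *: _]mulrC ler_pdivrMr// mulrC -ler_pdivrMr ?af//.
  by apply: maxy; apply/eqP.
Qed.

End Theory.
End Generators.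

(** * Lorentz cones *)

Section Lorentz.
Variables (R : realType) (n : nat).
Implicit Types u v p q : 'rV[R]_n.+1.
Local Notation L := (@lorentz_cone R n).

(** The Minkowski bilinear form, of signature (1, n). *)
Definition lform u v : R :=
  u 0 0 * v 0 0 - \sum_(i < n) u 0 (lift ord0 i) * v 0 (lift ord0 i).

Lemma lformC u v : lform u v = lform v u.
Proof.
by rewrite /lform mulrC; under eq_bigr do rewrite mulrC.
Qed.

Lemma lformDl u v w : lform (u + v) w = lform u w + lform v w.
Proof.
rewrite /lform mxE mulrDl; under eq_bigr do rewrite mxE mulrDl.
by rewrite big_split/= opprD addrACA.
Qed.

Lemma lformZl (a : R) u v : lform (a *: u) v = a * lform u v.
Proof.
rewrite /lform mxE mulrBr mulr_sumr mulrA; congr (_ - _).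
by apply: eq_bigr => i _; rewrite mxE mulrA.
Qed.

Lemma lform0l v : lform 0 v = 0.
Proof. by rewrite -(scale0r 0) lformZl mul0r. Qed.

Lemma lformDr u v w : lform u (v + w) = lform u v + lform u w.
Proof. by rewrite ![lform u _]lformC lformDl. Qed.

Lemma lformZr (a : R) u v : lform u (a *: v) = a * lform u v.
Proof. by rewrite ![lform u _]lformC lformZl. Qed.

Definition lformE := (lformDl, lformDr, lformZl, lformZr).

Lemma lorentz_coneP u : L u <-> 0 <= u 0 0 /\ 0 <= lform u u.
Proof.
have s0 : 0 <= \sum_(i < n) u 0 (lift ord0 i) ^+ 2.
  by apply: sumr_ge0 => i _; apply: sqr_ge0.
rewrite /lorentz_cone/= subr_ge0 -expr2; under [in X in _ <-> X]eq_bigr do rewrite -expr2.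
split=> [uL|[u0 su]].
  have u0 : 0 <= u 0 0 by apply: le_trans uL; apply: sqrtr_ge0.
  by split=> //; rewrite -(sqr_sqrtr s0) ler_pXn2r// nnegrE sqrtr_ge0.
by rewrite -(ger0_norm u0) -sqrtr_sqr ler_sqrt// sqr_ge0.
Qed.

Lemma lform_spacelike u : u 0 0 = 0 -> lform u u <= 0.
Proof.
move=> u0; rewrite /lform u0 mul0r sub0r oppr_le0.
by apply: sumr_ge0 => i _; rewrite -expr2 sqr_ge0.
Qed.

Lemma lorentz_cone_time0 u : L u -> u 0 0 = 0 -> u = 0.
Proof.
move=> /lorentz_coneP[_ uu] u0; apply/rowP => i; rewrite mxE.
move: uu; rewrite /lform u0 mul0r sub0r oppr_ge0 => s0.
have /psumr_eq0P sE : \sum_(i < n) u 0 (lift ord0 i) * u 0 (lift ord0 i) = 0.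
  by apply/eqP; rewrite eq_le s0 sumr_ge0// => j _; rewrite -expr2 sqr_ge0.
have [j ->|->] := unliftP ord0 i; last exact: u0.
apply/eqP; rewrite -sqrf_eq0 expr2; apply/eqP/sE => // k _.
by rewrite -expr2 sqr_ge0.
Qed.

(* The combination of [u] and [v] with vanishing time coordinate is spacelike. *)
Lemma lform_ge0 u v : L u -> L v -> 0 <= lform u v.
Proof.
move=> Lu Lv; have [u0 uu] := (lorentz_coneP u).1 Lu; have [v0 vv] := (lorentz_coneP v).1 Lv.
have [uz|un] := eqVneq (u 0 0) 0.
  by rewrite (lorentz_cone_time0 Lu uz) lform0l.
have [vz|vn] := eqVneq (v 0 0) 0.
  by rewrite (lorentz_cone_time0 Lv vz) lformC lform0l.
have : lform (v 0 0 *: u - u 0 0 *: v) (v 0 0 *: u - u 0 0 *: v) <= 0.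
  by apply: lform_spacelike; rewrite !mxE mulrC subrr.
rewrite -scaleNr !lformE [lform v u]lformC => h.
have uv0 : 0 < u 0 0 * v 0 0 by rewrite mulr_gt0// lt_neqAle eq_sym ?un ?vn.
rewrite -(pmulr_rge0 _ uv0).
have := mulr_ge0 (sqr_ge0 (v 0 0)) uu; have := mulr_ge0 (sqr_ge0 (u 0 0)) vv.
lra.
Qed.

(** A point of [L] with [lform p p > 0] is interior, so a small multiple of [q] can be subtracted:
    [t * a <= 1] controls the time coordinate and [t * b <= 1] the form. *)
Lemma lorentz_boundary p q : L p -> L q -> p != 0 ->
  (forall t : R, 0 < t -> ~ L (p - t *: q)) -> lform p p = 0.
Proof.
move=> Lp Lq pn nsub; have [p0 pp] := (lorentz_coneP p).1 Lp.
have [q0 qq] := (lorentz_coneP q).1 Lq; have pq := lform_ge0 Lp Lq.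
have {}p0 : 0 < p 0 0.
  rewrite lt_neqAle p0 andbT eq_sym; apply: contra_neq pn.
  exact: lorentz_cone_time0.
apply/eqP; rewrite eq_le pp andbT leNgt; apply/negP => {}pp.
pose a := q 0 0 / p 0 0; pose b := 2 * lform p q / lform p p.
have q0E : q 0 0 = a * p 0 0 by rewrite divfK// gt_eqF.
have pqE : 2 * lform p q = b * lform p p by rewrite divfK// gt_eqF.
have a0 : 0 <= a by rewrite divr_ge0// ltW.
have b0 : 0 <= b by rewrite !mulr_ge0// invr_ge0 ltW.
pose t := (1 + a + b)^-1.
have t0 : 0 < t by rewrite invr_gt0; lra.
have tE : t * (1 + a + b) = 1 by rewrite mulVf// gt_eqF//; lra.
have ta : t * a <= 1 by have := mulr_ge0 (ltW t0) b0; lra.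
have tb : t * b <= 1 by have := mulr_ge0 (ltW t0) a0; lra.
apply: (nsub t t0); apply/lorentz_coneP; split.
  rewrite !mxE q0E mulrA -{1}[p 0 0]mul1r -mulrBl.
  by rewrite mulr_ge0 ?subr_ge0// ltW.
rewrite -scaleNr !lformE [lform q p]lformC.
have -> : lform p p + - t * lform p q + (- t * lform p q + - t * (- t * lform q q)) =
    lform p p - t * (2 * lform p q) + t ^+ 2 * lform q q by ring.
rewrite pqE mulrA -{1}[lform p p]mul1r -mulrBl.
apply: addr_ge0; apply: mulr_ge0; rewrite ?sqr_ge0// ?(ltW pp)//.
by rewrite subr_ge0.
Qed.

(** Were [p] and [q] orthogonal, subtracting the multiple of [q] that cancels the time coordinate of
    [p] would leave a null vector at time 0, which lies in [L]. *)
Lemma lorentz_null_gt0 p q : L p -> L q -> p != 0 -> q != 0 ->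
  lform p p = 0 -> lform q q = 0 ->
  (forall t : R, 0 < t -> ~ L (p - t *: q)) -> 0 < lform p q.
Proof.
move=> Lp Lq pn qn pp qq nsub.
rewrite lt_neqAle (lform_ge0 Lp Lq) andbT; apply/negP => /eqP/esym pq.
have time_gt0 u : L u -> u != 0 -> 0 < u 0 0.
  move=> Lu un; rewrite lt_neqAle ((lorentz_coneP u).1 Lu).1 andbT eq_sym.
  by apply: contra_neq un; apply: lorentz_cone_time0.
have p0 := time_gt0 _ Lp pn; have q0 := time_gt0 _ Lq qn.
apply: (nsub (p 0 0 / q 0 0)); first exact: divr_gt0.
apply/lorentz_coneP; rewrite !mxE divfK ?gt_eqF// subrr; split=> //.
by rewrite -scaleNr !lformE [lform q p]lformC pp qq pq !mulr0 !addr0.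
Qed.

(** A direction orthogonal to both null vectors is tangent to the cone at [p]. The form on the curve
    is [e ^+ 2 * (lform v v + 2 k lform p q)], so [k] is chosen to outweigh [lform v v]; [e0] keeps
    the time coordinate nonnegative. *)
Lemma lorentz_curve p q v : L p -> L q -> p != 0 ->
  lform p p = 0 -> lform q q = 0 -> 0 < lform p q ->
  lform v p = 0 -> lform v q = 0 ->
  exists k e0 : R, 0 < e0 /\
    (forall e : R, `|e| <= e0 -> L (p + e *: v + e ^+ 2 *: (k *: q))).
Proof.
move=> Lp Lq pn pp qq pq vp vq.
have q0 := ((lorentz_coneP q).1 Lq).1.
have p0 : 0 < p 0 0.
  rewrite lt_neqAle ((lorentz_coneP p).1 Lp).1 andbT eq_sym.
  by apply: contra_neq pn; apply: lorentz_cone_time0.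
pose k := `|lform v v| / (2 * lform p q).
have k0 : 0 <= k by rewrite divr_ge0// mulr_ge0// ltW.
have v1 : 0 < `|v 0 0| + 1 by rewrite ltr_wpDl.
exists k, (p 0 0 / (`|v 0 0| + 1)); split; first exact: divr_gt0.
move=> e; rewrite ler_pdivlMr// => ep; apply/lorentz_coneP; split.
  rewrite !mxE; apply: addr_ge0; last by apply/mulr_ge0/mulr_ge0 => //; exact: sqr_ge0.
  have : `|e * v 0 0| <= p 0 0.
    by apply: le_trans ep; rewrite normrM ler_wpM2l// lerDl.
  by rewrite ler_norml => /andP[]; rewrite lerNl => h _; rewrite -lerBlDr sub0r.
have E : lform (p + e *: v + e ^+ 2 *: (k *: q)) (p + e *: v + e ^+ 2 *: (k *: q)) =
    e ^+ 2 * (lform v v + k * (2 * lform p q)).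
  rewrite !lformE [lform p v]lformC [lform q v]lformC [lform q p]lformC.
  by rewrite pp qq vp vq; ring.
rewrite E divfK; last by rewrite gt_eqF// mulr_gt0.
apply: mulr_ge0; first exact: sqr_ge0.
by rewrite -lerBlDl sub0r ler_normr lexx orbT.
Qed.

End Lorentz.

(** * Positive maps from a Lorentz cone reaching two extremal rays *)

Section TwoRays.
Variables (R : realType) (V : vectType R) (C : set V) (m : nat) (v : 'I_m -> V).
Hypotheses (properC : proper_cone C) (genC : generators C v).
Variables (n : nat) (b : 'Hom('rV[R]_n.+1, V)).
Local Notation L := (@lorentz_cone R n).
Hypothesis bL : forall u, L u -> C (b u).

Let nsub p q : extremal C (b p) -> L q ->
  (forall c : R, b q <> c *: b p) -> forall t : R, 0 < t -> ~ L (p - t *: q).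
Proof.
have [[C0 CD CZ] _ _ _] := properC.
move=> pC Lq qp t t0 /bL; rewrite linearB linearZ/= -[X in C (X - _)]scale1r => Cpq.
have [|d _ qE] := extremal_dominates properC pC _ ler01 Cpq.
  exact/CZ/bL/Lq/ltW.
apply: (qp (t^-1 * d)); rewrite -scalerA -qE scalerA mulVf ?scale1r//.
by rewrite gt_eqF.
Qed.

(* [p] and [q] are null vectors, and [b] kills the spacelike orthogonal       *)
(* complement of their span: it is tangent to both extremal rays.             *)
Lemma lorentz_two_rays p q : L p -> L q -> extremal C (b p) -> extremal C (b q) ->
  (forall c : R, b q <> c *: b p) ->
  exists s t : 'Hom('rV[R]_n.+1, R^o), [/\ forall u, L u -> 0 <= s u /\ 0 <= t u,
    s p = 1, s q = 0 & forall u, b u = s u *: b p + t u *: b q].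
Proof.
move=> Lp Lq pC qC qp.
have pq c : b p <> c *: b q.
  move=> pE; have [_ p0 _] := pC; have [c0|c0] := eqVneq c 0.
    by case/eqP: p0; rewrite pE c0 scale0r.
  by apply: (qp c^-1); rewrite pE scalerA mulVf// scale1r.
have pn : p != 0 by have [_ + _] := pC; apply: contra_neq => ->; rewrite linear0.
have qn : q != 0 by have [_ + _] := qC; apply: contra_neq => ->; rewrite linear0.
have nsubp := nsub pC Lq qp; have nsubq := nsub qC Lp pq.
have pp := lorentz_boundary Lp Lq pn nsubp.
have qq := lorentz_boundary Lq Lp qn nsubq.
have lpq := lorentz_null_gt0 Lp Lq pn qn pp qq nsubp.
have lpq0 : lform p q != 0 by rewrite gt_eqF.
have perp w : lform w p = 0 -> lform w q = 0 -> b w = 0.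
  move=> wp wq.
  have tangent p' q' : L p' -> L q' -> p' != 0 -> lform p' p' = 0 -> lform q' q' = 0 ->
      0 < lform p' q' -> extremal C (b p') -> lform w p' = 0 -> lform w q' = 0 ->
      exists c : R, b w = c *: b p'.
    move=> Lp' Lq' pn' pp' qq' pq' pC' wp' wq'.
    have [k [e0 [e00 curve]]] := lorentz_curve Lp' Lq' pn' pp' qq' pq' wp' wq'.
    apply: (extremal_tangent properC genC (z := b (k *: q')) pC' e00) => e ee.
    have := bL (curve e ee); rewrite !linearD [X in _ + X + _]linearZ.
    by rewrite [X in _ + _ + X]linearZ.
  have [c bw] := tangent p q Lp Lq pn pp qq lpq pC wp wq.
  have [|d bw'] := tangent q p Lq Lp qn qq pp _ qC wq wp; first by rewrite lformC.
  have [d0|d0] := eqVneq d 0; first by rewrite bw' d0 scale0r.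
  case: (qp (d^-1 * c)); rewrite -scalerA -bw bw' scalerA mulVf// scale1r.
  by [].
(* Since [p] and [q] are null, pairing with [q] and with [p] gives the coordinates of the orthogonal
   projection onto their span. *)
have functional_of z : exists s : 'Hom('rV[R]_n.+1, R^o),
    forall u, s u = lform u z / lform p q.
  by apply: functional_of_fun => a x y; rewrite !lformE mulrDl mulrA.
have [s sE] := functional_of q; have [t tE] := functional_of p.
exists s, t; split=> [u Lu|||u].
- by rewrite sE tE !divr_ge0 ?lform_ge0// ltW.
- by rewrite sE divff.
- by rewrite sE qq mul0r.
have : b (u - (s u *: p + t u *: q)) = 0.
  by apply: perp; rewrite -scaleN1r !lformE sE tE ?pp ?qq ?[lform q p]lformC; field.
by rewrite linearB linearD !linearZ => /eqP; rewrite subr_eq0 => /eqP.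
Qed.

End TwoRays.

(** * Factorable maps and their convex hull *)

Section Factorization.
Variables (R : realType) (V1 V2 : vectType R) (C1 : set V1) (C2 : set V2).
Implicit Types P Q : 'Hom(V1, V2).

Definition factorable P : Prop :=
  exists n (a : 'Hom(V1, 'rV[R]_n.+1)) (b : 'Hom('rV[R]_n.+1, V2)),
    [/\ forall x, C1 x -> @lorentz_cone R n (a x),
        forall u, @lorentz_cone R n u -> C2 (b u)
      & forall x, P x = b (a x)].

Lemma LorFactE : LorFact C1 C2 = convex_hull factorable.
Proof.
congr convex_hull; apply/seteqP; split=> [P|P [n [a [b [aP bP PE]]]]].
  move=> [W [L [[n [f [bij_f fL]]] [a [b [aP bP ->]]]]]].
  have [g fK gK] := bij_f.
  have [g' g'E] : exists g' : 'Hom('rV[R]_n.+1, W), forall u, g' u = g u.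
    by apply: hom_of_fun => c x y; apply: (can_inj fK); rewrite linearP/= !gK.
  exists n, (f \o a)%VF, (b \o g')%VF; split=> [x Cx|u Lu|x].
  - by rewrite -fL comp_lfunE; exists (a x) => //; apply: aP; exists x.
  - rewrite comp_lfunE g'E; apply: bP; exists (g u) => //.
    by move: Lu; rewrite -fL => -[w Lw <-]; rewrite fK.
  - by rewrite !comp_lfunE g'E fK.
exists 'rV[R]_n.+1, (@lorentz_cone R n); split.
  exists n, \1%VF; split; first by exists id => x; rewrite lfunE.
  apply/seteqP; split=> [_ [u Lu <-]|u Lu]; first by rewrite lfunE.
  by exists u; rewrite ?lfunE.
exists a, b; split=> [_ [x Cx <-]|_ [u Lu <-]|]; [exact: aP|exact: bP|].
by apply/lfunP => x; rewrite comp_lfunE PE.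
Qed.

Hypothesis cone2 : convex_cone C2.

Lemma factorableZ (c : R) P : 0 <= c -> factorable P -> factorable (c *: P).
Proof.
have [_ _ CZ] := cone2.
move=> c0 [n [a [b [aP bP PE]]]]; exists n, a, (c *: b); split=> // [u Lu|x].
  by rewrite scale_lfunE; apply: CZ => //; apply: bP.
by rewrite !scale_lfunE PE.
Qed.

(** The factorization passes through the half-line, which is [lorentz_cone R 0]. *)
Lemma factorable_rank1 (f : 'Hom(V1, R^o)) d P :
  (forall x, C1 x -> 0 <= f x) -> C2 d -> (forall x, P x = f x *: d) ->
  factorable P.
Proof.
have [_ _ CZ] := cone2; move=> f0 Cd PE.
have [a aE] : exists a : 'Hom(V1, 'rV[R]_1), forall x, a x = const_mx (f x).
  by apply: hom_of_fun => c x y; apply/rowP => i; rewrite !mxE !functionalE.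
have [b bE] : exists b : 'Hom('rV[R]_1, V2), forall u, b u = u 0 0 *: d.
  by apply: hom_of_fun => c x y; rewrite !mxE scalerDl scalerA.
exists 0%N, a, b; split=> [x Cx|u|x].
- rewrite aE; apply/lorentz_coneP; rewrite /lform big_ord0 subr0 !mxE.
  by split; [exact: f0|rewrite -expr2 sqr_ge0].
- by rewrite bE => /lorentz_coneP[u0 _]; apply: CZ.
- by rewrite bE aE mxE PE.
Qed.

(** Factorable maps are stable under nonnegative scaling, so a sum is the midpoint of the doubled
    summands; the free factor [c] lets the induction absorb the doubling. *)
Lemma sum_factorable_LorFact (s : seq 'Hom(V1, V2)) :
  (forall P, P \in s -> factorable P) -> LorFact C1 C2 (\sum_(P <- s) P).
Proof.
rewrite LorFactE => sP K [cvK fK].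
suff main (c : R) : 0 <= c -> K (c *: \sum_(P <- s) P).
  by rewrite -[X in K X]scale1r; apply: main.
elim: s sP c => [|P s IHs] sP c c0.
  rewrite big_nil scaler0; apply: fK; have [C0 _ _] := cone2.
  by apply: (@factorable_rank1 0 0 0 _ C0) => x; rewrite !zero_lfunE ?scaler0.
have KP : K ((2 * c) *: P).
  by apply/fK/factorableZ; [rewrite mulr_ge0|apply: sP; rewrite mem_head].
have Ks : K ((2 * c) *: \sum_(P <- s) P).
  by apply: IHs => [Q Qs|]; [apply: sP; rewrite in_cons Qs orbT|rewrite mulr_ge0].
have h0 : 0 <= 2^-1 :> R by lra.
have h1 : 2^-1 <= 1 :> R by lra.
have := cvK _ _ (Itv01 h0 h1) (mem_set KP) (mem_set Ks).
rewrite inE /conv/= big_cons scalerDr; congr K.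
by rewrite !scalerA; congr (_ *: _ + _ *: _); rewrite /= ?/unstable.onem; field.
Qed.

Lemma LorFact_sum P : LorFact C1 C2 P ->
  exists2 s : seq 'Hom(V1, V2), forall Q, Q \in s -> factorable Q &
    P = \sum_(Q <- s) Q.
Proof.
rewrite LorFactE => HP; apply: (HP [set P | _]); split; last first.
  move=> Q fQ; exists [:: Q]; last by rewrite big_seq1.
  by move=> Q'; rewrite inE => /eqP->.
move=> P1 P2 l /[!inE] -[s1 s1P ->] [s2 s2P ->].
exists ([seq l%:num *: Q | Q <- s1] ++ [seq (1 - l%:num) *: Q | Q <- s2]).
  move=> Q; rewrite mem_cat => /orP[] /mapP[Q' Q's ->]; apply: factorableZ; rewrite ?subr_ge0//;
    by [apply: s1P|apply: s2P].
by rewrite big_cat !big_map/= -!scaler_sumr.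
Qed.

Lemma factorable_Pos P x : factorable P -> C1 x -> C2 (P x).
Proof. by move=> [n [a [b [aP bP ->]]]] Cx; apply/bP/aP. Qed.

Lemma LorFact_sub_Pos : LorFact C1 C2 `<=` Pos C1 C2.
Proof.
have [C0 CD _] := cone2.
move=> P /LorFact_sum[s sP ->] _ [x Cx <-]; rewrite sum_lfunE big_seq.
by apply: (big_ind C2) => // Q /sP fQ; apply: factorable_Pos.
Qed.

End Factorization.

(** * Polyhedral pairs with the Lorentz factorization property *)

Section Main.
Variables (R : realType) (V1 V2 : vectType R) (C1 : set V1) (C2 : set V2).
Variables (m1 m2 : nat) (v : 'I_m1 -> V1) (w : 'I_m2 -> V2).
Hypotheses (proper1 : proper_cone C1) (gen1 : generators C1 v).
Hypotheses (proper2 : proper_cone C2) (gen2 : generators C2 w).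

Let cone2 : convex_cone C2. Proof. by case: proper2. Qed.

Lemma generators_Pos (P : 'Hom(V1, V2)) :
  (forall i, C2 (P (v i))) -> Pos C1 C2 P.
Proof.
have [C0 CD CZ] := cone2; have [_ _ gK] := gen1.
move=> Pv _ [x Cx <-]; apply: (gK [set x | C2 (P x)]) => //.
split=> [|y z|a y a0] /=; first by rewrite linear0.
  by rewrite linearD; apply: CD.
by rewrite linearZ; apply: CZ.
Qed.

Lemma rank1_hom (f : 'Hom(V1, R^o)) d :
  exists Q : 'Hom(V1, V2), forall x, Q x = f x *: d.
Proof.
by apply: hom_of_fun => a x y; rewrite !functionalE scalerDl scalerA.
Qed.

Lemma simplicial_LFP : m1 = \dim {:V1} \/ m2 = \dim {:V2} -> LFP C1 C2.
Proof.
move=> md; apply/seteqP; split; first exact: LorFact_sub_Pos.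
move=> P PP; have {}PP x : C1 x -> C2 (P x) by move=> Cx; apply: PP; exists x.
have sum_rank1 m (f : 'I_m -> 'Hom(V1, R^o)) (d : 'I_m -> V2) :
    (forall i x, C1 x -> 0 <= f i x) -> (forall i, C2 (d i)) ->
    (forall x, P x = \sum_i f i x *: d i) -> LorFact C1 C2 P.
  move=> f0 Cd PE; have [Q QE] := choice (fun i => rank1_hom (f i) (d i)).
  have -> : P = \sum_(P <- [seq Q i | i <- enum 'I_m]) P.
    apply/lfunP => x; rewrite big_map big_enum sum_lfunE PE.
    by apply: eq_bigr => i _; rewrite QE.
  apply: sum_factorable_LorFact => // _ /mapP[i _ ->].
  exact: (factorable_rank1 cone2 (f0 i) (Cd i)).
have [/(simplicial_coordinates proper1 gen1)[f [f0 fE]]|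
      /(simplicial_coordinates proper2 gen2)[f [f0 fE]]] := md.
  apply: (sum_rank1 _ f (fun i => P (v i))) => // [i|x].
    exact/PP/(generator_in gen1).
  by rewrite {1}(fE x) linear_sum; apply: eq_bigr => i _; rewrite linearZ.
apply: (sum_rank1 _ (fun i => f i \o P)%VF w) => [i x Cx|i|x].
- by rewrite comp_lfunE; apply/f0/PP.
- exact: (generator_in gen2).
- by rewrite {1}(fE (P x)); apply: eq_bigr => i _; rewrite comp_lfunE.
Qed.

(* The two rank-one terms of [lorentz_two_rays] would split the facet          *)
(* functional proportional to [g \o P] into two non-proportional parts.       *)
Lemma not_factorable (P : 'Hom(V1, V2)) (f : 'Hom(V1, R^o)) (g : 'Hom(V2, R^o)) x y :
  facet v f -> C1 x -> C1 y -> f x != 0 -> f y != 0 -> extremal C2 (P x) -> extremal C2 (P y) ->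
  (forall c : R, P y <> c *: P x) -> 0 < g (P x) -> 0 < g (P y) ->
  (forall i, f (v i) = 0 -> g (P (v i)) = 0) -> ~ factorable C1 C2 P.
Proof.
move=> [f0 fmax] Cx Cy fx fy Px Py Pxy gx gy gP [n [a [b [aP bP PE]]]].
rewrite !PE in Px Py gx gy Pxy.
have [s [t [st0 sx sy bE]]] :=
  lorentz_two_rays proper2 gen2 bP (aP x Cx) (aP y Cy) Px Py Pxy.
have [i fi|r sE] := fmax (s \o a)%VF.
  rewrite comp_lfunE; have [si ti] := st0 _ (aP _ (generator_in gen1 i)).
  have := gP i fi; rewrite PE bE !functionalE => /eqP.
  rewrite paddr_eq0 ?mulr_ge0 ?(ltW gx) ?(ltW gy)// mulf_eq0 (gt_eqF gx) orbF.
  by case/andP => /eqP.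
have := sE y; rewrite comp_lfunE sy => /esym/eqP.
rewrite mulf_eq0 (negbTE fy) orbF => /eqP r0.
have := sE x; rewrite comp_lfunE sx r0 mul0r => /eqP.
by rewrite oner_eq0.
Qed.

Lemma LFP_simplicial : LFP C1 C2 -> m1 = \dim {:V1} \/ m2 = \dim {:V2}.
Proof.
have [C0 CD CZ] := cone2.
move=> lfp; apply: contrapT => /not_orP[md1 md2].
have [f [i1 [j1 [facet_f ij1 fi1 fj1]]]] := facet_missing_two proper1 gen1 md1.
have [a [a1 [x [y [[Cx Cy] [fx fy] [ax ay] [a1x a1y] av]]]]] :=
  face_off_facet proper1 gen1 facet_f.1 ij1 fi1 fj1.
have [g [k [l [facet_g kl gk gl]]]] := facet_missing_two proper2 gen2 md2.
pose d3 := (g (w k))^-1 *: w k; pose d4 := (g (w l))^-1 *: w l.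
have [ext2 dist2 _] := gen2.
have d3C : extremal C2 d3 by apply: (extremalZ proper2) => //; rewrite invr_gt0.
have d4C : extremal C2 d4 by apply: (extremalZ proper2) => //; rewrite invr_gt0.
have [Cd3 _ _] := d3C; have [Cd4 _ _] := d4C.
have gd3 : g d3 = 1 by rewrite functionalZ mulVf ?gt_eqF.
have gd4 : g d4 = 1 by rewrite functionalZ mulVf ?gt_eqF.
have d34 c : d4 <> c *: d3.
  move=> d4E; case/eqP: kl; apply/esym; apply: (dist2 _ _ (g (w l) * (c * (g (w k))^-1))).
  by rewrite -!scalerA -d4E scalerA divff ?scale1r// gt_eqF.
clearbody d3 d4.
pose h := \sum_(i | g (w i) == 0) w i.
have Ch : C2 h by apply: (big_ind C2) => // i _; apply: (generator_in gen2).
have gh : g h = 0 by rewrite linear_sum big1// => i /eqP.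
have [|K K0 CK] := facet_absorb proper2 gen2 (x := d4 - d3) facet_g.
  by rewrite !functionalE gd3 gd4 subrr.
(* Being a sum of nonnegative ratios, [M] dominates each of them; where [a (v i) = 0] the quotient
   is 0 by convention. *)
pose M := \sum_i a1 (v i) * K / a (v i).
have M_ge i : 0 < a (v i) -> a1 (v i) * K <= M * a (v i).
  move=> ai; rewrite -ler_pdivrMr// /M (bigD1 i)//= lerDl sumr_ge0// => j _.
  by have [a0 a10 _] := av j; rewrite divr_ge0// mulr_ge0.
have [W WE] : exists W : 'Hom(V1, V2),
    forall z, W z = f z *: d3 + a1 z *: (d4 - d3) + (M * a z) *: h.
  have [Q3 Q3E] := rank1_hom f d3; have [Q4 Q4E] := rank1_hom a1 (d4 - d3).
  have [Qh QhE] := rank1_hom (M *: a) h.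
  by exists (Q3 + Q4 + Qh) => z; rewrite !add_lfunE Q3E Q4E QhE scale_lfunE.
have gW z : g (W z) = f z.
  by rewrite WE !functionalE gd3 gd4 gh subrr !mulr0 !addr0 mulr1.
have Wx : W x = d3 by rewrite WE fx ax a1x mulr0 !scale0r !addr0 scale1r.
have Wy : W y = d4 by rewrite WE fy ay a1y mulr0 scale0r addr0 !scale1r addrC subrK.
have PosW : Pos C1 C2 W.
  apply: generators_Pos => i; have [a0 a10 af] := av i; rewrite WE.
  have f0 := facet_f.1 i.
  (* Where [a] vanishes the value is [(f - a1) d3 + a1 d4]; elsewhere the multiple of [h]
     compensates for [d4 - d3]. *)
  have [ai|ai] := eqVneq (a (v i)) 0.
    rewrite ai mulr0 scale0r addr0 scalerBr addrCA -scalerBl.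
    by apply: CD; apply: CZ => //; rewrite subr_ge0 af.
  have {}ai : 0 < a (v i) by rewrite lt_neqAle eq_sym ai.
  have -> : f (v i) *: d3 + a1 (v i) *: (d4 - d3) + (M * a (v i)) *: h =
      f (v i) *: d3 + (a1 (v i) *: (d4 - d3 + K *: h) + (M * a (v i) - a1 (v i) * K) *: h).
    by rewrite [a1 _ *: (_ + K *: h)]scalerDr scalerA scalerBl -!addrA [a1 _ * K *: h + _]addrC subrK.
  apply: (CD); first exact: CZ.
  by apply: CD; apply: CZ => //; rewrite subr_ge0 M_ge.
have /(LorFact_sum cone2)[s sfact WsE] : LorFact C1 C2 W by rewrite lfp.
have sumW z : g (W z) = \sum_(P <- s) g (P z).
  by rewrite WsE sum_lfunE linear_sum.
have [P Ps gPx] : exists2 P, P \in s & 0 < g (P x).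
  apply: contrapT => nP; have : g (W x) <= 0.
    rewrite sumW big_seq; apply: sumr_le0 => P Ps; rewrite leNgt; apply/negP => gP.
    by apply: nP; exists P.
  by rewrite gW fx ler10.
have Pz z : C1 z -> C2 (P z) by move=> Cz; exact: factorable_Pos (sfact _ Ps) Cz.
have WPz z : C1 z -> C2 (W z - P z).
  move=> Cz; rewrite WsE (big_rem P Ps)/= add_lfunE addrAC subrr add0r sum_lfunE big_seq.
  apply: (big_ind C2) => // Q /mem_rem/sfact Qf; exact: factorable_Pos Cz.
have g2 := generators_ge0 gen2 facet_g.1.
(* [P z] lies below the extremal vector [d], hence is a multiple of it, and [g] reads off the
   factor. *)
have Pd z d : C1 z -> W z = d -> extremal C2 d -> g d = 1 -> P z = g (P z) *: d.
  move=> Cz Wz dC gd.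
  have [|c _ cE] := extremal_dominates proper2 dC (Pz z Cz) ler01.
    by rewrite scale1r -Wz; apply: WPz.
  by rewrite cE functionalZ gd mulr1.
have Pf z : f z = 0 -> C1 z -> g (P z) = 0.
  move=> fz Cz; apply/eqP; rewrite eq_le g2 ?andbT; last exact: Pz.
  by have := g2 _ (WPz z Cz); rewrite !functionalE gW fz sub0r oppr_ge0.
(* [g \o P] vanishes at the generators killed by [f], so it is a multiple of the facet functional
   [f]; as [f x = f y], the factors at [x] and [y] agree and both are positive. *)
have [i fi|c gPE] := facet_f.2 (g \o P)%VF.
  by rewrite comp_lfunE; apply: Pf => //; apply: (generator_in gen1).
have gPxy : g (P y) = g (P x).
  by have := gPE x; have := gPE y; rewrite !comp_lfunE fx fy => -> ->.
have PxE := Pd x d3 Cx Wx d3C gd3; have PyE := Pd y d4 Cy Wy d4C gd4.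
rewrite gPxy in PyE.
apply: (not_factorable (P := P) (g := g) facet_f Cx Cy) (sfact P Ps).
- by rewrite fx oner_neq0.
- by rewrite fy oner_neq0.
- by rewrite PxE; apply: (extremalZ proper2).
- by rewrite PyE; apply: (extremalZ proper2).
- move=> c'; rewrite PxE PyE scalerA mulrC -scalerA => PE; apply: (d34 c').
  by apply: (scalerI (lt0r_neq0 gPx)).
- by [].
- by rewrite gPxy.
- by move=> i fi; apply: Pf => //; apply: (generator_in gen1).
Qed.

End Main.

Theorem theorem2 (R : realType) (V1 V2 : vectType R)
    (C1 : set V1) (C2 : set V2)
    (proper_C1 : proper_cone C1) (polyhedral_C1 : polyhedral C1)
    (proper_C2 : proper_cone C2) (polyhedral_C2 : polyhedral C2) :
  LFP C1 C2 <-> classical_cone C1 \/ classical_cone C2.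
Proof.
have [m1 [v [gen1 cl1]]] := polyhedral_generators proper_C1 polyhedral_C1.
have [m2 [w [gen2 cl2]]] := polyhedral_generators proper_C2 polyhedral_C2.
rewrite cl1 cl2; split; first exact: LFP_simplicial gen1 proper_C2 gen2.
exact: simplicial_LFP gen1 proper_C2 gen2.
Qed.
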